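(* Let $n$ be a positive integer, let $x_0<x_1<\cdots<x_n$ be real numbers, let $u_0,u_1,\dots,u_n\in\mathbf{R}_F$ be fuzzy numbers, and put $I=[x_0,x_n]$, $I_i=[x_{i-1},x_i]$ for $i=1,\dots,n$. For $i=1,\dots,n$ let $l_i:I\to I_i$ be a contractive homeomorphism with $l_i(x_0)=x_{i-1}$ and $l_i(x_n)=x_i$, let $s_i$ be a constant with $0\le s_i<1$, and let $q_i:I_i\to\mathbf{R}_F$ be a Lipschitz mapping (with respect to $d_\infty$ on $\mathbf{R}_F$) such that the mapping $F_i:I\times\mathbf{R}_F\to\mathbf{R}_F$, $F_i(x,u)=s_iu\oplus q_i(l_i(x))$, satisfies $F_i(x_0,u_0)=u_{i-1}$ and $F_i(x_n,u_n)=u_i$. Define $w_i:I\times\mathbf{R}_F\to I_i\times\mathbf{R}_F$ by $w_i(x,u)=(l_i(x),F_i(x,u))$. Then the attractor $B$ of the iterated function system $\{I\times\mathbf{R}_F;\,w_i=(l_i,F_i),\ i=1,\dots,n\}$ is the graph of a fuzzy-valued continuous function, i.e. there is a continuous function $f:I\to(\mathbf{R}_F,d_\infty)$ with $B=\{(x,f(x)):x\in I\}$.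
   Context: A fuzzy number is a function $u:\mathbf{R}\to[0,1]$ that is normal ($u(y)=1$ for some $y$), upper semicontinuous, convex ($u(ty+(1-t)z)\ge\min\{u(y),u(z)\}$ for all $y,z\in\mathbf{R}$, $t\in[0,1]$) and compactly supported (the closure of $\{y:u(y)>0\}$ is compact). $\mathbf{R}_F$ is the set of fuzzy numbers. For $u\in\mathbf{R}_F$, the $\lambda$-level set is $[u]^\lambda=\{y:u(y)\ge\lambda\}$ for $\lambda\in(0,1]$ and $[u]^0=\overline{\{y:u(y)>0\}}$; it is a closed interval, written $[u^-(\lambda),u^+(\lambda)]$. The operations are defined by level sets: $[u\oplus v]^\lambda=[u]^\lambda+[v]^\lambda$ and $[cu]^\lambda=c[u]^\lambda$ for $c\in\mathbf{R}$ (Minkowski sum and scaling of intervals). The metric on $\mathbf{R}_F$ is $d_\infty(u,v)=\sup_{\lambda\in[0,1]}\max\{|u^-(\lambda)-v^-(\lambda)|,|u^+(\lambda)-v^+(\lambda)|\}$; $(\mathbf{R}_F,d_\infty)$ is a complete metric space. $I\times\mathbf{R}_F$ carries the metric $d_{\max}((x,u),(y,v))=\max\{|x-y|,d_\infty(u,v)\}$ and is complete. A mapping between metric spaces is contractive if it is Lipschitz with some constant in $[0,1)$. Under the hypotheses of the claim there is a metric $d_\theta$ on $I\times\mathbf{R}_F$, equivalent to $d_{\max}$ (each bounded by a positive constant times the other), for which all $w_i$ are contractive. Let $H(I\times\mathbf{R}_F)$ be the family of nonempty compact subsets of $I\times\mathbf{R}_F$ with the Hausdorff distance, and $W:H(I\times\mathbf{R}_F)\to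 H(I\times\mathbf{R}_F)$, $W(A)=\bigcup_{i=1}^n w_i(A)$. The attractor $B$ of the iterated function system is the unique fixed point of $W$, i.e. the unique nonempty compact set with $B=\bigcup_{i=1}^n w_i(B)$. *)

(* Defs.v *)
From HB Require Import structures.
From mathcomp Require Import all_boot all_order all_algebra.
From mathcomp Require Import all_classical all_reals all_analysis.
From mathcomp Require Import ring lra.

Set Implicit Arguments.
Unset Strict Implicit.
Unset Printing Implicit Defensive.

Import Order.TTheory GRing.Theory Num.Theory.
Import numFieldNormedType.Exports.
Local Open Scope classical_set_scope.
Local Open Scope ring_scope.

Definition upper_semicontinuous (R : realType) (f : R -> R) :=
  forall y a, f y < a -> \forall z \near y, f z < a.

Record fuzzy (R : realType) := Fuzzy {
  membership :> R -> R;
  membership_ge0 : forall y, 0 <= membership y;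
  membership_le1 : forall y, membership y <= 1;
  fuzzy_normal : exists y, membership y = 1;
  fuzzy_usc : upper_semicontinuous membership;
  fuzzy_convex : forall y z t, 0 <= t <= 1 ->
    Num.min (membership y) (membership z) <= membership (t * y + (1 - t) * z);
  fuzzy_compact_support : compact (closure [set y | 0 < membership y]) }.

HB.instance Definition _ (R : realType) := gen_eqMixin (fuzzy R).
HB.instance Definition _ (R : realType) := gen_choiceMixin (fuzzy R).

Section levels.
Context {R : realType}.
Implicit Types (u v w : fuzzy R) (a b : R).

(* Meaningful for 0 <= a <= 1 only. *)
Definition level u a : set R :=
  if a == 0 then closure [set y | 0 < u y] else [set y | a <= u y].

Definition lower u a : R := inf (level u a).
Definition upper u a : R := sup (level u a).

Definition dinf u v : R :=
  sup [set Num.max `|lower u a - lower v a| `|upper u a - upper v a|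
      | a in `[0, 1]%classic].

Lemma level0 u : level u 0 = closure [set y | 0 < u y].
Proof. by rewrite /level eqxx. Qed.

Lemma level_gt0 u a : 0 < a -> level u a = [set y | a <= u y].
Proof. by move=> a0; rewrite /level gt_eqF. Qed.

Lemma level_sub0 u a : 0 <= a -> level u a `<=` level u 0.
Proof.
rewrite le_eqVlt => /predU1P[<-//|a0]; rewrite level_gt0// level0 => y /= ay.
by apply: subset_closure => /=; exact: lt_le_trans ay.
Qed.

Lemma level_dec u a b : 0 <= a -> a <= b -> level u b `<=` level u a.
Proof.
rewrite le_eqVlt => /predU1P[<-|a0] ab; first exact: level_sub0.
by rewrite !level_gt0//; [move=> y /=; exact: le_trans|exact: lt_le_trans ab].
Qed.

Lemma level_nonempty u a : a <= 1 -> level u a !=set0.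
Proof.
have [y uy] := fuzzy_normal u.
move=> a1; exists y; rewrite /level; case: ifPn => _ /=.
  by apply: subset_closure => /=; rewrite uy.
by rewrite uy.
Qed.

Lemma level_closed u a : closed (level u a).
Proof.
rewrite /level; case: ifPn => _; first exact: closed_closure.
rewrite -openC openE => y /= /negP; rewrite -ltNge => uya.
by apply: filterS (fuzzy_usc uya) => z /=; rewrite ltNge => /negP.
Qed.

Lemma level_compact u a : 0 <= a -> compact (level u a).
Proof.
move=> a0; apply: (subclosed_compact (@level_closed u a)) (level_sub0 a0).
by rewrite level0; exact: fuzzy_compact_support.
Qed.

Lemma between_comb (x y z : R) : x <= z <= y ->
  exists2 t : R, 0 <= t <= 1 & z = t * x + (1 - t) * y.
Proof.
move=> /andP[xz zy]; have [xy|xy] := eqVneq x y.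
  exists 0; first by rewrite lexx ler01.
  by rewrite mul0r add0r subr0 mul1r; apply/eqP; rewrite eq_le zy -xy xz.
have d0 : 0 < y - x by rewrite subr_gt0 lt_neqAle xy (le_trans xz).
exists ((y - z) / (y - x)).
  apply/andP; split; first by apply: divr_ge0; lra.
  by rewrite ler_pdivrMr// mul1r; lra.
by field; rewrite gt_eqF.
Qed.

Lemma level_interval_gt0 u a : 0 < a -> is_interval (level u a).
Proof.
move=> a0 x y; rewrite level_gt0//= => ax ay z /between_comb[t t01 ->].
by apply: le_trans (fuzzy_convex _ _ _ t01); rewrite le_min ax.
Qed.

Lemma is_interval_closure (A : set R) : is_interval A -> is_interval (closure A).
Proof.
move=> iA x y Ax Ay z /andP[]; rewrite le_eqVlt => /predU1P[<-//|xz].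
rewrite le_eqVlt => /predU1P[->//|zy]; apply: subset_closure.
have [x' [Ax' x'z]] := Ax _ (lt_nbhsl xz).
have [y' [Ay' y'z]] := Ay _ (lt_nbhsr zy).
by apply: (iA x' y') => //; rewrite !ltW.
Qed.

Lemma level_interval u a : 0 <= a -> is_interval (level u a).
Proof.
rewrite le_eqVlt => /predU1P[<-|]; last exact: level_interval_gt0.
rewrite level0; apply: is_interval_closure => x y /= ux uy z xzy.
have m0 : 0 < Num.min (u x) (u y) by rewrite lt_min ux.
have /(_ x y) := @level_interval_gt0 u _ m0; rewrite level_gt0//=.
rewrite !ge_min !lexx orbT => /(_ isT isT _ xzy).
exact: lt_le_trans.
Qed.

Lemma level_has_sup u a : 0 <= a <= 1 -> has_sup (level u a).
Proof.
move=> /andP[a0 a1].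
by apply: compact_has_sup; [exact: level_nonempty|exact: level_compact].
Qed.

Lemma level_has_inf u a : 0 <= a <= 1 -> has_inf (level u a).
Proof.
move=> /andP[a0 a1].
apply/has_inf_supN/compact_has_sup.
  by apply: image_nonempty; exact: level_nonempty.
apply: continuous_compact; last exact: level_compact.
by apply: continuous_subspaceT => x; exact: opp_continuous.
Qed.

Lemma level_itv u a : 0 <= a <= 1 ->
  level u a = `[lower u a, upper u a]%classic.
Proof.
move=> a01; have [a0 a1] := andP a01.
have hs := level_has_sup u a01; have hi := level_has_inf u a01.
have Ls : level u a (upper u a).
  by apply: level_closed; apply: closure_sup; case: hs.
have Li : level u a (lower u a).
  apply: level_closed => B /nbhs_ballP[e /= e0 eB].
  have [y yA ye] := inf_adherent e0 hi.
  exists y; split => //; apply: eB; rewrite /ball/= distrC ger0_norm.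
    by rewrite ltrBlDl.
  by rewrite subr_ge0; apply: ge_inf => //; case: hi.
apply/seteqP; split => [y Ly|y /=]; rewrite /= in_itv/=.
  apply/andP; split; first by apply: ge_inf => //; case: hi.
  by apply: ub_le_sup => //; case: hs.
by move=> yi; exact: level_interval yi.
Qed.

Lemma lower_le_upper u a : 0 <= a <= 1 -> lower u a <= upper u a.
Proof.
move=> a01; have [a0 a1] := andP a01; have [y] := level_nonempty u a1.
by rewrite level_itv//= in_itv/= => /andP[]; exact: le_trans.
Qed.

Lemma lower_mono u a b : 0 <= a -> a <= b -> b <= 1 -> lower u a <= lower u b.
Proof.
move=> a0 ab b1.
have b01 : 0 <= b <= 1 by rewrite (le_trans a0).
have a01 : 0 <= a <= 1 by rewrite a0 (le_trans ab).
have : level u b (lower u b) by rewrite level_itv//= in_itv/= lexx lower_le_upper.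
by move=> /(level_dec a0 ab); rewrite level_itv//= in_itv/= => /andP[].
Qed.

Lemma upper_anti u a b : 0 <= a -> a <= b -> b <= 1 -> upper u b <= upper u a.
Proof.
move=> a0 ab b1.
have b01 : 0 <= b <= 1 by rewrite (le_trans a0).
have a01 : 0 <= a <= 1 by rewrite a0 (le_trans ab).
have : level u b (upper u b) by rewrite level_itv//= in_itv/= lexx lower_le_upper.
by move=> /(level_dec a0 ab); rewrite level_itv//= in_itv/= => /andP[].
Qed.

Lemma fuzzy_eqP u v : u =1 v -> u = v.
Proof.
case: u v => [f f1 f2 f3 f4 f5 f6] [g g1 g2 g3 g4 g5 g6] /= /funext fg.
by subst g; congr Fuzzy; exact: Prop_irrelevance.
Qed.

Lemma level_inj u v :
  (forall a, 0 < a <= 1 -> level u a = level v a) -> u = v.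
Proof.
move=> uv; apply: fuzzy_eqP => y.
suff H u1 v1 : (forall a, 0 < a <= 1 -> level u1 a = level v1 a) -> u1 y <= v1 y.
  by apply/eqP; rewrite eq_le !H// => a a01; rewrite uv.
move=> {}uv; have := membership_ge0 u1 y; rewrite le_eqVlt => /predU1P[<-|u0].
  exact: membership_ge0.
have := uv (u1 y); rewrite u0 membership_le1 => /(_ isT) /seteqP[/(_ y) + _].
by rewrite !level_gt0//=; apply.
Qed.

End levels.

Section dinf_metric.
Context {R : realType}.
Implicit Types (u v w : fuzzy R) (a b : R).

Let gap u v a : R :=
  Num.max `|lower u a - lower v a| `|upper u a - upper v a|.

Let dinfE u v : dinf u v = sup [set gap u v a | a in `[0, 1]%classic].
Proof. by []. Qed.

Let gap_bound u v : has_ubound [set gap u v a | a in `[0, 1]%classic].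
Proof.
exists (`|upper u 0 - lower v 0| + `|upper v 0 - lower u 0|).
move=> y [a /=].
rewrite in_itv/= => a01 <-; have [a0 a1] := andP a01.
have z01 : 0 <= 0 :> R by [].
have := lower_mono u z01 a0 a1; have := upper_anti u z01 a0 a1.
have := lower_mono v z01 a0 a1; have := upper_anti v z01 a0 a1.
have := lower_le_upper u a01; have := lower_le_upper v a01.
have := ler_norm (upper u 0 - lower v 0).
have := ler_norm (upper v 0 - lower u 0).
have := normr_ge0 (upper u 0 - lower v 0).
have := normr_ge0 (upper v 0 - lower u 0).
rewrite /gap ge_max !ler_norml => *.
by apply/andP; split; apply/andP; split; lra.
Qed.

Let gap0 u v : [set gap u v a | a in `[0, 1]%classic] !=set0.
Proof. by apply: image_nonempty; exists 0 => /=; rewrite in_itv/= lexx ler01. Qed.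

Lemma dinf_ge u v a : 0 <= a <= 1 ->
  Num.max `|lower u a - lower v a| `|upper u a - upper v a| <= dinf u v.
Proof. by move=> a01; apply: (ub_le_sup (gap_bound u v)); exists a => //=; rewrite in_itv. Qed.

Lemma dinf_le u v (e : R) :
  (forall a, 0 <= a <= 1 ->
    Num.max `|lower u a - lower v a| `|upper u a - upper v a| <= e) ->
  dinf u v <= e.
Proof. move=> H; apply: ge_sup; first exact: gap0.
by move=> y [a /=]; rewrite in_itv => ? <-; exact: H. Qed.

Lemma dinfxx u : dinf u u = 0.
Proof.
apply/eqP; rewrite eq_le; apply/andP; split.
  by apply: dinf_le => a _; rewrite !subrr !normr0 maxxx.
by have := @dinf_ge u u 0; rewrite lexx ler01 !subrr !normr0 maxxx; apply.
Qed.

Lemma dinf_sym u v : dinf u v = dinf v u.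
Proof.
rewrite !dinfE; congr sup; apply: eq_imagel => a _.
by rewrite /gap distrC [X in Num.max _ X]distrC.
Qed.

Lemma dinf_triangle v u w : dinf u w <= dinf u v + dinf v w.
Proof.
apply: dinf_le => a a01.
have := dinf_ge u v a01; have := dinf_ge v w a01.
rewrite !ge_max => /andP[l1 r1] /andP[l2 r2].
apply/andP; split; [apply: le_trans (ler_distD (lower v a) _ _) _|
                    apply: le_trans (ler_distD (upper v a) _ _) _]; exact: lerD.
Qed.

Lemma dinf_positivity u v : dinf u v = 0 -> u = v.
Proof.
move=> uv; apply: level_inj => a /andP[a0 a1].
have a01 : 0 <= a <= 1 by rewrite ltW.
have := dinf_ge u v a01; rewrite uv ge_max !normr_le0 !subr_eq0.
by move=> /andP[/eqP l /eqP r]; rewrite !level_itv// l r.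
Qed.

End dinf_metric.

HB.instance Definition _ (R : realType) :=
  isMetric.Build R (fuzzy R) (@dinfxx R) (@dinf_positivity R)
    (@dinf_sym R) (@dinf_triangle R).

Section fuzzy_of_levels.
Context {R : realType} (L : R -> set R).
Hypothesis L1 : L 1 !=set0.
Hypothesis Lclosed : forall a, 0 < a <= 1 -> closed (L a).
Hypothesis Linterval : forall a, 0 < a <= 1 -> is_interval (L a).
Hypothesis Ldec : forall a b, 0 < a -> a <= b -> b <= 1 -> L b `<=` L a.
Hypothesis Lleft : forall a y, 0 < a <= 1 ->
  (forall b, 0 < b < a -> L b y) -> L a y.
Hypothesis L0compact : compact (L 0).
Hypothesis L0E :
  closure [set y | exists2 a, 0 < a <= 1 & L a y] = L 0.

Let S y : set R := [set a | a = 0 \/ 0 < a <= 1 /\ L a y].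
Let m y : R := sup (S y).

Let S0 y : S y !=set0. Proof. by exists 0; left. Qed.

Let Sub y : ubound (S y) 1.
Proof. by move=> a [->//|[/andP[]]]. Qed.

Let m_ge0 y : 0 <= m y.
Proof. by apply: ub_le_sup; [exists 1; exact: Sub|left]. Qed.

Let m_le1 y : m y <= 1.
Proof. by apply: ge_sup; [exact: S0|exact: Sub]. Qed.

Let mP a y : 0 < a <= 1 -> (a <= m y) <-> L a y.
Proof.
move=> a01; split=> [am|Lay]; last first.
  by apply: ub_le_sup; [exists 1; exact: Sub|right].
apply: Lleft => // b /andP[b0 ba].
have [c [c0|[/andP[c0 c1] Lcy]] bc] := sup_gt (S0 y) (lt_le_trans ba am).
  by move: bc; rewrite c0 ltNge (ltW b0).
exact: Ldec (ltW bc) c1 _ Lcy.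
Qed.

Let m_normal : exists y, m y = 1.
Proof.
have [y Ly] := L1; exists y; apply/eqP; rewrite eq_le m_le1/=.
by apply/mP => //; rewrite ltr01 lexx.
Qed.

Let m_usc : upper_semicontinuous m.
Proof.
move=> y a ya; have a0 : 0 < a := le_lt_trans (m_ge0 y) ya.
have [a1|a1] := leP a 1; last by near=> z; exact: le_lt_trans a1.
have a01 : 0 < a <= 1 by rewrite a0.
have : (~` L a) y by move=> /(mP _ a01); rewrite leNgt ya.
have : open (~` L a) by rewrite openC; exact: Lclosed.
rewrite openE => /[apply]; rewrite /interior/=; apply: filterS => z /= Laz.
by rewrite ltNge; apply/negP => /(mP _ a01).
Unshelve. all: by end_near. Qed.

Let m_convex y z t : 0 <= t <= 1 ->
  Num.min (m y) (m z) <= m (t * y + (1 - t) * z).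
Proof.
move=> /andP[t0 t1]; set a := Num.min _ _.
have [a0|a0] := leP a 0; first exact: le_trans (m_ge0 _).
have a01 : 0 < a <= 1 by rewrite a0 ge_min m_le1.
have Ly : L a y by apply/(mP _ a01); rewrite ge_min lexx.
have Lz : L a z by apply/(mP _ a01); rewrite ge_min lexx orbT.
apply/(mP _ a01); have [yz|zy] := leP y z.
  by apply: (Linterval a01 Ly Lz); apply/andP; split; nra.
by apply: (Linterval a01 Lz Ly); apply/andP; split; nra.
Qed.

Let m_support : closure [set y | 0 < m y] = L 0.
Proof.
rewrite -L0E; congr closure; apply/seteqP; split => y /=.
  by move=> my; exists (m y); [rewrite my m_le1|apply/mP; rewrite ?my ?m_le1].
by move=> [a a01 /(mP _ a01)]; apply: lt_le_trans; case/andP: a01.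
Qed.

Let m_compact : compact (closure [set y | 0 < m y]).
Proof. by rewrite m_support. Qed.

Lemma fuzzy_of_levels :
  {w : fuzzy R | forall a, 0 <= a <= 1 -> level w a = L a}.
Proof.
exists (Fuzzy m_ge0 m_le1 m_normal m_usc m_convex m_compact).
move=> a /andP[]; rewrite le_eqVlt => /predU1P[<- _|a0 a1].
  by rewrite level0.
have a01 : 0 < a <= 1 by rewrite a0.
by rewrite level_gt0//; apply/seteqP; split => y /= /(mP _ a01).
Qed.

End fuzzy_of_levels.

Section operations.
Context {R : realType}.
Implicit Types (u v w : fuzzy R) (a b c : R).

Let level_left u a y : 0 < a -> ~ level u a y ->
  exists2 b, 0 < b < a & forall c, b <= c -> ~ level u c y.
Proof.
move=> a0; rewrite level_gt0//= => /negP; rewrite -ltNge => uya.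
have u0 := membership_ge0 u y.
exists ((u y + a) / 2); first by apply/andP; split; lra.
by move=> c bc; rewrite level_gt0/=; [apply/negP; rewrite -ltNge|]; lra.
Qed.

Let lower_left u a (e : R) : 0 < a <= 1 -> 0 < e ->
  exists2 b, 0 < b < a &
    forall c, b <= c -> c <= a -> lower u a - e < lower u c.
Proof.
move=> /andP[a0 a1] e0; have a01 : 0 <= a <= 1 by rewrite ltW.
have /(level_left a0)[b /andP[b0 ba] H] : ~ level u a (lower u a - e).
  by rewrite level_itv//= in_itv/= => /andP[]; lra.
exists b => [|c bc ca]; first by rewrite b0.
have c0 : 0 <= c by lra.
have c01 : 0 <= c <= 1 by rewrite c0 (le_trans ca).
have := H _ bc; rewrite level_itv//= in_itv/= => /negP.
rewrite negb_and -!ltNge => /orP[//|].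
have := upper_anti u c0 ca a1; have := lower_le_upper u a01; lra.
Qed.

Let upper_left u a (e : R) : 0 < a <= 1 -> 0 < e ->
  exists2 b, 0 < b < a &
    forall c, b <= c -> c <= a -> upper u c < upper u a + e.
Proof.
move=> /andP[a0 a1] e0; have a01 : 0 <= a <= 1 by rewrite ltW.
have /(level_left a0)[b /andP[b0 ba] H] : ~ level u a (upper u a + e).
  by rewrite level_itv//= in_itv/= => /andP[]; lra.
exists b => [|c bc ca]; first by rewrite b0.
have c0 : 0 <= c by lra.
have c01 : 0 <= c <= 1 by rewrite c0 (le_trans ca).
have := H _ bc; rewrite level_itv//= in_itv/= => /negP.
rewrite negb_and -!ltNge => /orP[|//].
have := lower_mono u c0 ca a1; have := lower_le_upper u a01; lra.
Qed.

Let sum u v a : set R := [set y + z | y in level u a & z in level v a].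

Let sumE u v a : 0 <= a <= 1 ->
  sum u v a = `[lower u a + lower v a, upper u a + upper v a]%classic.
Proof.
move=> a01; have lu := lower_le_upper u a01; have lv := lower_le_upper v a01.
apply/seteqP; split => [_ [y + [z + <-]]|x /=].
  by rewrite !level_itv//= !in_itv/= => /andP[? ?] /andP[? ?]; apply/andP; split; lra.
rewrite in_itv/= => /andP[lx xu]; rewrite /sum !level_itv//.
have [h|h] := leP (lower u a) (x - upper v a).
  exists (x - upper v a); first by rewrite /= in_itv/=; apply/andP; split; lra.
  exists (upper v a); last by ring.
  by rewrite /= in_itv/= lv lexx.
exists (lower u a); first by rewrite /= in_itv/= lu lexx.
exists (x - lower u a); last by ring.
by rewrite /= in_itv/=; apply/andP; split; lra.
Qed.

Lemma fuzzy_add_subproof u v :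
  {w : fuzzy R | forall a, 0 <= a <= 1 ->
    level w a = [set y + z | y in level u a & z in level v a]}.
Proof.
have sW a : 0 < a <= 1 -> 0 <= a <= 1 by move=> /andP[/ltW-> ->].
apply: (@fuzzy_of_levels R (sum u v)).
- have [y uy] := @level_nonempty R u 1 (lexx _).
  have [z vz] := @level_nonempty R v 1 (lexx _).
  by exists (y + z); exists y => //; exists z.
- by move=> a /sW a01; rewrite sumE//; exact: itv_closed.
- by move=> a /sW a01; rewrite sumE//; exact: interval_is_interval.
- move=> a b /ltW a0 ab b1 _ [y uy [z vz <-]].
  by exists y; [exact: level_dec uy|exists z => //; exact: level_dec vz].
- move=> a x a01 H; have /andP[a0 a1] := a01; have a01' := sW _ a01.
  rewrite sumE//= in_itv/=; apply/andP; split; rewrite leNgt; apply/negP => lt.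
    pose e := (lower u a + lower v a - x) / 2.
    have e0 : 0 < e by rewrite /e; lra.
    have [b1 /andP[b10 b1a] H1] := lower_left u a01 e0.
    have [b2 /andP[b20 b2a] H2] := lower_left v a01 e0.
    pose b := Num.max b1 b2.
    have b1b : b1 <= b by rewrite le_max lexx.
    have b2b : b2 <= b by rewrite le_max lexx orbT.
    have ba : b < a by rewrite gt_max b1a.
    have b0 : 0 < b by lra.
    have /H : 0 < b < a by rewrite b0.
    rewrite sumE//= ?in_itv/=; last by apply/andP; split; lra.
    move=> /andP[+ _].
    have := H1 _ b1b (ltW ba); have := H2 _ b2b (ltW ba); rewrite /e; lra.
  pose e := (x - (upper u a + upper v a)) / 2.
  have e0 : 0 < e by rewrite /e; lra.
  have [b1 /andP[b10 b1a] H1] := upper_left u a01 e0.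
  have [b2 /andP[b20 b2a] H2] := upper_left v a01 e0.
  pose b := Num.max b1 b2.
  have b1b : b1 <= b by rewrite le_max lexx.
  have b2b : b2 <= b by rewrite le_max lexx orbT.
  have ba : b < a by rewrite gt_max b1a.
  have b0 : 0 < b by lra.
  have /H : 0 < b < a by rewrite b0.
  rewrite sumE//= ?in_itv/=; last by apply/andP; split; lra.
  move=> /andP[_].
  have := H1 _ b1b (ltW ba); have := H2 _ b2b (ltW ba); rewrite /e; lra.
- by rewrite sumE ?lexx ?ler01//; exact: segment_compact.
- apply/seteqP; split.
    have cl : closed (sum u v 0) by rewrite sumE ?lexx ?ler01//; exact: itv_closed.
    rewrite closureE; apply: smallest_sub => // x [a /sW/andP[a0 _]].
    by move=> [y uy [z vz <-]]; exists y; [exact: level_sub0 uy|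
      exists z => //; exact: level_sub0 vz].
  move=> _ [y uy [z vz <-]] B nB.
  have := @add_continuous R (y, z) B nB.
  move: uy vz; rewrite !level0 => uy vz [/= [U V] [/= nU nV] UVB].
  have [y' [/= uy' Uy']] := uy _ nU; have [z' [/= vz' Vz']] := vz _ nV.
  exists (y' + z'); split; last exact: (UVB (y', z')).
  have m0 : 0 < Num.min (u y') (v z') by rewrite lt_min uy'.
  exists (Num.min (u y') (v z')); first by rewrite m0 ge_min membership_le1.
  exists y'; first by rewrite level_gt0//= ge_min lexx.
  by exists z' => //; rewrite level_gt0//= ge_min lexx orbT.
Qed.

Lemma fuzzy_scale_subproof c u :
  {w : fuzzy R | forall a, 0 <= a <= 1 ->
    level w a = [set c * y | y in level u a]}.
Proof.
have sW a : 0 < a <= 1 -> 0 <= a <= 1 by move=> /andP[/ltW-> ->].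
have cc : continuous (fun y : R => c * y) by exact: mulrl_continuous.
have cpt a : 0 <= a -> compact [set c * y | y in level u a].
  move=> a0; apply: continuous_compact; last exact: level_compact.
  exact: continuous_subspaceT.
apply: (@fuzzy_of_levels R (fun a => [set c * y | y in level u a])).
- by apply: image_nonempty; exact: level_nonempty.
- move=> a /sW/andP[a0 _]; apply: compact_closed (cpt _ a0).
  exact: Rhausdorff.
- move=> a /andP[/ltW a0 a1] _ _ [y uy <-] [z uz <-] x /between_comb[t t01 ->].
  exists (t * y + (1 - t) * z); last by ring.
  have /andP[t0 t1] := t01; have [yz|zy] := leP y z.
    by apply: (level_interval a0 uy uz); apply/andP; split; nra.
  by apply: (level_interval a0 uz uy); apply/andP; split; nra.
- by move=> a b /ltW a0 ab b1; apply: image_subset; exact: level_dec.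
- move=> a x a01 H; have /andP[a0 a1] := a01.
  have [c0|c0] := eqVneq c 0.
    have /H[y _ <-] : 0 < a / 2 < a by apply/andP; split; lra.
    have [z uz] := level_nonempty u a1.
    by exists z => //; rewrite c0 !mul0r.
  exists (x / c); last by rewrite mulrC divfK.
  rewrite level_gt0//= leNgt; apply/negP => ua.
  have u0 := membership_ge0 u (x / c).
  have b0 : 0 < (u (x / c) + a) / 2 by lra.
  have /H[y + yx] : 0 < (u (x / c) + a) / 2 < a by apply/andP; split; lra.
  have -> : y = x / c by rewrite -yx mulrC mulKf.
  by rewrite level_gt0//=; lra.
- exact: cpt.
- apply/seteqP; split.
    have cl : closed [set c * y | y in level u 0].
      by apply: compact_closed (cpt _ _) => //; exact: Rhausdorff.
    rewrite closureE; apply: smallest_sub => // x [a /sW/andP[a0 _]].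
    by apply: image_subset; exact: level_sub0.
  move=> _ [y + <-] B /cc; rewrite level0 => /[apply] -[z [/= uz Bz]].
  exists (c * z); split => //; exists (u z); first by rewrite uz membership_le1.
  by exists z => //; rewrite level_gt0//=.
Qed.

End operations.

(* A fuzzy number is determined by its level sets (level_inj), so the
   following are the only operations with the stated level sets. *)
Definition fuzzy_add (R : realType) (u v : fuzzy R) : fuzzy R :=
  sval (fuzzy_add_subproof u v).

Definition fuzzy_scale (R : realType) (c : R) (u : fuzzy R) : fuzzy R :=
  sval (fuzzy_scale_subproof c u).

Lemma level_add (R : realType) (u v : fuzzy R) (a : R) : 0 <= a <= 1 ->
  level (fuzzy_add u v) a = [set y + z | y in level u a & z in level v a].
Proof. exact: (svalP (fuzzy_add_subproof u v)). Qed.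

Lemma level_scale (R : realType) (c : R) (u : fuzzy R) (a : R) : 0 <= a <= 1 ->
  level (fuzzy_scale c u) a = [set c * y | y in level u a].
Proof. exact: (svalP (fuzzy_scale_subproof c u)). Qed.

(* On the reals, mdist is available as (R^o : metricType R), where it is the
   usual distance; on fuzzy R it is dinf. *)
Lemma mdist_fuzzyE (R : realType) (u v : fuzzy R) : mdist u v = dinf u v.
Proof. by []. Qed.

(* The product (pseudo)metric on R * fuzzy R is the maximum metric. *)
Lemma ball_dmax (R : realType) (p p' : R * fuzzy R) (e : R) :
  ball p e p' <-> Num.max `|p.1 - p'.1| (dinf p.2 p'.2) < e.
Proof.
rewrite gt_max; split => [[b1 b2]|/andP[b1 b2]].
  by apply/andP; split => //; move: b2; rewrite ballEmdist.
by split => //; rewrite ballEmdist.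
Qed.

Section mappings.
Context {R : realType}.

Definition lipschitz_with (X Y : metricType R) (A : set X) (k : R) (f : X -> Y) :=
  forall x y, A x -> A y -> mdist (f x) (f y) <= k * mdist x y.

Definition lipschitz_map (X Y : metricType R) (A : set X) (f : X -> Y) :=
  exists2 k : R, 0 <= k & lipschitz_with A k f.

Definition contractive_map (X Y : metricType R) (A : set X) (f : X -> Y) :=
  exists2 k : R, 0 <= k < 1 & lipschitz_with A k f.

Definition homeomorphism (X Y : topologicalType) (A : set X) (B : set Y)
    (f : X -> Y) :=
  [/\ set_bij A B f, {within A, continuous f} &
    exists2 g : Y -> X, {within B, continuous g} & {in A, cancel f g}].

End mappings.

Section iterated_function_system.
Context {T : topologicalType} {n : nat}.
Implicit Types (w : 'I_n -> T -> T) (X A B : set T).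

Definition hutchinson w A : set T := \bigcup_(i : 'I_n) (w i @` A).

Definition hutchinson_fixed X w B :=
  [/\ B !=set0, compact B, B `<=` X & hutchinson w B = B].

Definition is_attractor X w B :=
  hutchinson_fixed X w B /\ forall C, hutchinson_fixed X w C -> C = B.

End iterated_function_system.

Section fuzzy_interpolation.
Context {R : realType} {n : nat}.

Definition left_node (i : 'I_n) : 'I_n.+1 := widen_ord (leqnSn n) i.
Definition right_node (i : 'I_n) : 'I_n.+1 := lift ord0 i.

Definition node_interval (x : 'I_n.+1 -> R) : set R :=
  `[x ord0, x ord_max]%classic.

Definition node_subinterval (x : 'I_n.+1 -> R) (i : 'I_n) : set R :=
  `[x (left_node i), x (right_node i)]%classic.

Definition fif_F (l : 'I_n -> R -> R) (s : 'I_n -> R) (q : 'I_n -> R -> fuzzy R)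
    (i : 'I_n) (t : R) (v : fuzzy R) : fuzzy R :=
  fuzzy_add (fuzzy_scale (s i) v) (q i (l i t)).

Definition fif_w (l : 'I_n -> R -> R) (s : 'I_n -> R) (q : 'I_n -> R -> fuzzy R)
    (i : 'I_n) (p : R * fuzzy R) : R * fuzzy R :=
  (l i p.1, fif_F l s q i p.1 p.2).

End fuzzy_interpolation.

(* Main.v *)
Require Import Defs.
From HB Require Import structures.
From mathcomp Require Import all_boot all_order all_algebra.
From mathcomp Require Import all_classical all_reals all_analysis.
From mathcomp Require Import ring lra.
Set Implicit Arguments.
Unset Strict Implicit.
Unset Printing Implicit Defensive.
Import Order.TTheory GRing.Theory Num.Theory.
Import numFieldNormedType.Exports.
Local Open Scope classical_set_scope.
Local Open Scope ring_scope.

(** The fixed graph is built first, and the attractor is then read off from it.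

    A function f whose graph is invariant satisfies f (l_i t) = F_i (t, f t)
    for every i and every t in I.  Such an f is the limit of the iteration
    g_(m+1) (l_i t) = F_i (t, g_m t): two consecutive iterates differ by at
    most M * c ^ m with c = max s_i < 1, and the space of fuzzy numbers is
    complete.  The intervals I_i overlap at the interior nodes, so each iterate
    is well defined only because the values at x_0 and x_n are u_0 and u_n; the
    join-up conditions on F_i preserve these two values, and they make both
    prescriptions at x_i equal to u_i.  The iteration starts from a step
    function, continuity being a matter for the limit alone.  This is
    exists_invariant_function.

    Continuity of f comes afterwards, from self-similarity: the oscillation of
    f at l_i t is at most c times its oscillation at t.  Since f is bounded,
    the oscillation vanishes everywhere (invariant_function_continuous).

    The graph of f is then compact and invariant.  If C is another nonempty
    compact invariant set, the vertical distance from a point of C to the graph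
    is bounded on C and shrinks by the factor c under each w_i, hence is 0;
    the projection of C to I is closed, and it comes within Delta * k ^ m of
    every point of I for all m because the l_i contract and their images
    cover I.  So C is the whole graph (invariant_graph_attractor).

    Completeness is proved on the end points of level sets.  Along a Cauchy
    filter they converge uniformly in the level, and a uniform limit of end
    points of fuzzy numbers is again the pair of end points of a fuzzy number
    (fuzzy_of_uniform_limit). *)

(** * Metric spaces *)

Local Notation mdist_cvg_lt :=
  metric_structure.metricType_numDomainType.cvgr_dist_lt.
Local Notation mdist_fcvgP :=
  metric_structure.metricType_numDomainType.fcvgrPdist_lt.
Local Notation mdist_cvgP :=
  metric_structure.metricType_numDomainType.cvgrPdist_lt.

(** Completeness as a predicate: the bundled complete structures require a
    distinguished point. *)
Definition cauchy_complete (R : realType) (Y : metricType R) :=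
  forall G : set_system Y, ProperFilter G -> cauchy G -> exists y : Y, G --> y.

Section metric_facts.
Context {R : realType}.

Lemma mdist_lim_le (Y : metricType R) (I : Type) (G : set_system I)
    (u : I -> Y) (a y : Y) (r : R) : ProperFilter G ->
  u @ G --> y -> (\forall i \near G, mdist a (u i) <= r) -> mdist a y <= r.
Proof.
move=> GG uy ur; apply/ler_addgt0Pr => e e0.
have /filter_ex[i [ai yi]] : \forall i \near G,
    mdist a (u i) <= r /\ mdist y (u i) < e.
  by apply: filterI => //; exact: mdist_cvg_lt.
by rewrite (le_trans (metric_triangle _ (u i) _))// lerD// metric_sym ltW.
Qed.

Lemma compact_mdist_bounded (X : metricType R) (A : set X) (a : X) :
  compact A -> exists M : R, forall x, A x -> mdist a x <= M.
Proof.
move=> cA; have ca : continuous (fun x : X => mdist a x : R).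
  move=> x; apply/cvgrPdist_lt => e e0.
  apply: (filterS _ (mdist_cvg_lt (@cvg_id _ (nbhs x)) e0)) => y /= xy.
  rewrite ltr_norml; have := metric_triangle a y x.
  by have := metric_triangle a x y; rewrite (metric_sym y x); lra.
have cm : compact [set mdist a x | x in A].
  by apply: continuous_compact => //; exact: continuous_subspaceT.
have [M [_ MP]] := compact_bounded cm.
exists (M + 1) => x Ax; rewrite (le_trans (ler_norm _))//.
by apply: MP; [rewrite ltrDl|exists x].
Qed.

Lemma geometric_lt (M c e : R) : 0 <= c < 1 -> 0 < e -> exists m, M * c ^+ m < e.
Proof.
move=> /andP[c0 c1] e0.
have c1' : `|c| < 1 by rewrite ger0_norm.
have /cvgrPdist_lt/(_ _ e0)/filter_ex[m] := cvg_geometric M c1'.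
by rewrite /geometric/= sub0r normrN => /ltr_normlW; exists m.
Qed.

Lemma geometric_le0 (M c r : R) : 0 <= c < 1 ->
  (forall m, r <= M * c ^+ m) -> r <= 0.
Proof.
move=> c01 H; rewrite leNgt; apply/negP => /(geometric_lt M c01)[m].
by rewrite ltNge H.
Qed.

Lemma mdist_geometric_eq (Y : metricType R) (M c : R) (x y : Y) : 0 <= c < 1 ->
  (forall m, mdist x y <= M * c ^+ m) -> x = y.
Proof.
move=> c01 /(geometric_le0 c01) xy; apply: mdist_positivity.
by apply/eqP; rewrite eq_le xy mdist_ge0.
Qed.

(** Summing the steps gives the bound M * c ^ m * (1 - c ^ j) / (1 - c) on the
    distance from u m to u (m + j), which is uniform in j. *)
Lemma geometric_cauchy_cvg (Y : metricType R) (u : nat -> Y) (M c : R) :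
  cauchy_complete Y ->
  0 <= M -> 0 <= c < 1 -> (forall m, mdist (u m) (u m.+1) <= M * c ^+ m) ->
  exists y, forall m, mdist (u m) y <= M / (1 - c) * c ^+ m.
Proof.
move=> Ycomplete M0 c01 uM; have /andP[c0 c1] := c01.
have c10 : 0 < 1 - c by lra.
have tail m j : mdist (u m) (u (m + j)%N) <= M / (1 - c) * c ^+ m.
  suff H : (1 - c) * mdist (u m) (u (m + j)%N) <= M * c ^+ m * (1 - c ^+ j).
    rewrite mulrAC ler_pdivlMr// mulrC (le_trans H)//.
    by rewrite ler_piMr ?mulr_ge0 ?exprn_ge0// gerBl exprn_ge0.
  elim: j => [|j IHj]; first by rewrite addn0 mdistxx expr0 subrr !mulr0.
  rewrite addnS (le_trans (ler_wpM2l (ltW c10) (metric_triangle _ (u (m + j)%N) _)))//.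
  rewrite mulrDr (le_trans (lerD IHj (ler_wpM2l (ltW c10) (uM (m + j)%N))))//.
  by rewrite exprD exprS; lra.
have /(Ycomplete _ _)[y uy] : cauchy (u @ \oo).
  apply: cauchy_exP => e e0.
  have [m me] := geometric_lt (M / (1 - c)) c01 e0.
  exists (u m); exists m => //= j mj; rewrite ballEmdist/=.
  by rewrite -(subnKC mj) (le_lt_trans (tail _ _)).
exists y => m; apply: (mdist_lim_le _ uy); exists m => //= j mj.
by rewrite -(subnKC mj).
Qed.

(** The limit r is introduced together with its rate, in the form in which a
    whole family of functions h has limits that are uniform in the family: the
    balls v e do not depend on h. *)
Lemma nonexpansive_cauchy_limit (Y : metricType R) (G : set_system Y)
    (h : Y -> R) : ProperFilter G -> cauchy G ->
  (forall x y, `|h x - h y| <= mdist x y) ->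
  exists r, forall x e, G (ball x e) -> `|h x - r| <= e.
Proof.
move=> GG /cauchyP Gc h1; exists (lim (h @ G)) => x e Gxe.
have /cauchy_cvg hG : cauchy (h @ G).
  apply: cauchy_exP => e' /Gc[y Gy]; exists (h y).
  have sub : ball y e' `<=` h @^-1` ball (h y) e'.
    by move=> z; rewrite ballEmdist /ball/= => yz; exact: le_lt_trans yz.
  exact: filterS sub Gy.
apply/ler_addgt0Pr => d d0.
have /filter_ex[y [xy yr]] :
    \forall y \near G, ball x e y /\ `|lim (h @ G) - h y| < d.
  by apply: filterI => //; move/cvgrPdist_lt : hG; apply.
have hxy := h1 x y; move: xy; rewrite ballEmdist/= => xy.
rewrite -(subrKA (h y)) (le_trans (ler_normD _ _))// lerD//.
  by rewrite (le_trans hxy)// ltW.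
by rewrite distrC ltW.
Qed.

End metric_facts.

(** * Invariant graphs of iterated function systems *)

Section invariant_graph.
Context {R : realType} {X Y : metricType R} {n : nat}.
Variables (D : set X) (l : 'I_n -> X -> X) (F : 'I_n -> X -> Y -> Y).

Definition skew_product i (p : X * Y) : X * Y := (l i p.1, F i p.1 p.2).

(** The equation that makes the graph of f over D carried into itself by each
    map of the system. *)
Definition invariant_function (f : X -> Y) :=
  forall i t, D t -> f (l i t) = F i t (f t).

Hypothesis D_self_similar : hutchinson l D = D.

Let l_maps i t : D t -> D (l i t).
Proof. by move=> Dt; rewrite -D_self_similar; exists i => //; exists t. Qed.

Let l_covers t : D t -> exists i s, D s /\ l i s = t.
Proof. by rewrite -{1}D_self_similar => -[i _ [s Ds <-]]; exists i, s. Qed.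

Variable c : R.
Hypothesis c01 : 0 <= c < 1.

(** The domains l_i D of the defining equation may overlap, and P is the class
    of functions on which the prescriptions agree there.  All
    iterates lie in P; the limit inherits the equation from the contraction in
    the second variable, through the geometric rate of convergence. *)
Lemma exists_invariant_function (P : set (X -> Y)) (g0 : X -> Y) (M : R) :
  cauchy_complete Y ->
  (forall i t v v', D t -> mdist (F i t v) (F i t v') <= c * mdist v v') ->
  (forall g i j t t', P g -> D t -> D t' -> l i t = l j t' ->
    F i t (g t) = F j t' (g t')) ->
  (forall g h, P g -> (forall i t, D t -> h (l i t) = F i t (g t)) -> P h) ->
  P g0 -> 0 <= M ->
  (forall i t, D t -> mdist (g0 (l i t)) (F i t (g0 t)) <= M) ->
  exists2 f, invariant_function f &
    forall t, D t -> mdist (g0 t) (f t) <= M / (1 - c).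
Proof.
move=> Ycomplete Fc coherent stable Pg0 M0 g0M; have /andP[c0 c1] := c01.
have /choice[T TP] : forall g, exists h, P g ->
    forall i t, D t -> h (l i t) = F i t (g t).
  move=> g; have [Pg|] := pselect (P g); last by exists g.
  have /choice[h hP] : forall s, exists y, forall i t, D t -> l i t = s ->
      y = F i t (g t).
    move=> s; have [[i [t [Dt <-]]]|no] := pselect (exists i t, D t /\ l i t = s).
      by exists (F i t (g t)) => j t' Dt' e; apply: coherent.
    by exists (g s) => i t Dt ts; exfalso; apply: no; exists i, t.
  by exists h => _ i t Dt; exact: hP.
pose G m := iter m T g0.
have PG m : P (G m) by elim: m => // m Pm; apply: stable (Pm) _; exact: TP.
have GS m i t : D t -> G m.+1 (l i t) = F i t (G m t) by exact: TP.
have Gstep m t : D t -> mdist (G m t) (G m.+1 t) <= M * c ^+ m.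
  elim: m t => [|m IHm] _ /l_covers[i [t [Dt <-]]]; rewrite !GS//.
    by rewrite expr0 mulr1; exact: g0M.
  rewrite (le_trans (Fc _ _ _ _ Dt))//.
  by rewrite exprS mulrCA ler_wpM2l ?IHm.
have /choice[f fP] : forall t, exists y, D t ->
    forall m, mdist (G m t) y <= M / (1 - c) * c ^+ m.
  move=> t; have [Dt|] := pselect (D t); last by exists (g0 t).
  have [y yP] := geometric_cauchy_cvg Ycomplete M0 c01 (fun m => Gstep m t Dt).
  by exists y.
exists f => [i t Dt|t Dt]; last by have := fP t Dt 0%N; rewrite expr0 mulr1.
(* Both sides are within c * (M / (1 - c)) * c ^ m of F_i (t, g_m t), which
   is the value of the next iterate at l_i t. *)
apply: (@mdist_geometric_eq _ _ (2 * c * (M / (1 - c))) _ _ _ c01) => m.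
rewrite (le_trans (metric_triangle _ (G m.+1 (l i t)) _))//.
have := fP _ (l_maps i Dt) m.+1; have := ler_wpM2l c0 (fP t Dt m).
have := Fc i t (G m t) (f t) Dt; rewrite -GS// metric_sym exprS.
by rewrite [mdist _ (f (l i t))]metric_sym; lra.
Qed.

(** If f oscillates by less than e at every point of D, it does so by less than
    c' * e for any c' in ]c, 1[: near t, a point t' lies in some l_i D, and if
    t does too then both are pulled back by the continuous inverse of l_i to
    close points s and s', where f differs by less than e.  The images l_i D
    that miss t are closed and finitely many, hence stay away from t. *)
Lemma invariant_function_continuous (K M : R) (f : X -> Y) :
  compact D -> (forall i, homeomorphism D (l i @` D) (l i)) ->
  0 <= K ->
  (forall i t t' v v', D t -> D t' ->
    mdist (F i t v) (F i t' v') <= K * mdist t t' + c * mdist v v') ->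
  invariant_function f ->
  (forall t t', D t -> D t' -> mdist (f t) (f t') <= M) ->
  {within D, continuous f}.
Proof.
move=> Dcompact lhomeo K0 FL finv fM; have /andP[c0 c1] := c01.
pose osc_lt e := forall t, D t ->
  \forall t' \near within D (nbhs t), mdist (f t) (f t') < e.
(* The gap between c and c' absorbs the dependence of F_i on its first
   variable. *)
pose c' := (1 + c) / 2.
have osc_step e : 0 < e -> osc_lt e -> osc_lt (c' * e).
  move=> e0 osc t Dt.
  suff : \forall t' \near within D (nbhs t), forall i, (l i @` D) t' ->
      mdist (f t) (f t') < c' * e.
    move=> near_t.
    have near_D : \forall t' \near within D (nbhs t), D t' by exact: withinT.
    apply: filterS2 near_t near_D => t' + Dt'.
    by have [i [s [Ds <-]]] := l_covers Dt'; apply; exists s.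
  apply: filter_forall => i; have [_ lc [g gc gK]] := lhomeo i.
  have [[s Ds st]|lt] := pselect ((l i @` D) t); last first.
    suff near_t : \forall t' \near t, (~` (l i @` D)) t'.
      by apply: cvg_within; apply: filterS near_t => t' no /no.
    apply: open_nbhs_nbhs; split => //; rewrite openC.
    apply: compact_closed; first exact: metric_hausdorff.
    exact: continuous_compact.
  pose eta := (1 - c) / 4 * e / (K + 1).
  have eta0 : 0 < eta by rewrite divr_gt0 ?mulr_gt0//; lra.
  have near_s : \forall s' \near within D (nbhs s),
      mdist (f s) (f s') < e /\ mdist s s' < eta.
    apply: filterI; first exact: osc.
    by apply: cvg_within; apply: mdist_cvg_lt eta0; exact: cvg_id.
  have gt : g @ within (l i @` D) (nbhs t) --> s.
    rewrite -[X in _ --> X](gK s) ?inE// st.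
    by move/subspace_continuousP : gc; apply; exists s.
  have near_t : \forall t' \near t, (l i @` D) t' -> D (g t') ->
      mdist (f s) (f (g t')) < e /\ mdist s (g t') < eta by exact: gt near_s.
  apply: cvg_within; apply: filterS near_t => t' + lt'.
  move=> /(_ lt'); case: lt' => s' Ds' <-; rewrite /= gK ?inE// => /(_ Ds')[fss' ss'].
  rewrite -st !finv// (le_lt_trans (FL _ _ _ _ _ Ds Ds'))//.
  have := ler_wpM2l c0 (ltW fss'); have := ler_wpM2l K0 (ltW ss').
  have : (K + 1) * eta = (1 - c) / 4 * e by rewrite mulrC divfK//; lra.
  have : 0 < (1 - c) * e by rewrite mulr_gt0//; lra.
  by rewrite /c'; lra.
have c'01 : 0 <= c' < 1 by rewrite /c'; lra.
(* The step from e to c' * e needs e positive, and M may be 0. *)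
pose M' := `|M| + 1.
have M'0 : 0 < M' by rewrite ltr_wpDl.
have osc_pow m : osc_lt (M' * c' ^+ m).
  elim: m => [t Dt|m IHm].
    rewrite expr0 mulr1; apply: filterS (withinT D _) => t' Dt'.
    by rewrite (le_lt_trans (fM _ _ Dt Dt'))// (le_lt_trans (ler_norm _))// ltrDl.
  rewrite exprS mulrCA; apply: osc_step => //.
  by rewrite mulr_gt0// exprn_gt0// /c'; lra.
apply/subspace_continuousP => t Dt; apply/mdist_cvgP => e e0.
have [m me] := geometric_lt M' c'01 e0.
by apply: filterS (osc_pow m t Dt) => t' /lt_trans; exact.
Qed.

(** Uniqueness is a direct comparison of a compact invariant set C with the
    graph.  Every point of C is an image of a point of C, which contracts the
    vertical distance to the graph; every point of D is an image of a point of
    D, which contracts the distance to the projection of C. *)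
Lemma invariant_graph_attractor (k : R) (f : X -> Y) :
  compact D -> D !=set0 -> 0 <= k < 1 ->
  (forall i, lipschitz_with D k (l i)) ->
  (forall i t v v', D t -> mdist (F i t v) (F i t v') <= c * mdist v v') ->
  invariant_function f -> {within D, continuous f} ->
  is_attractor (D `*` [set: Y]) skew_product [set (t, f t) | t in D].
Proof.
move=> Dcompact [t0 Dt0] k01 lk Fc finv fcont.
have /andP[k0 k1] := k01; have /andP[c0 c1] := c01.
split.
  split.
  - by exists (t0, f t0); exists t0.
  - apply: continuous_compact => //; apply/subspace_continuousP => t Dt.
    apply: cvg_pair; first by apply: cvg_within_filter; exact: cvg_id.
    by move/subspace_continuousP : fcont; exact.
  - by move=> _ [t Dt <-].
  - apply/seteqP; split.
      move=> _ [i _ [_ [t Dt <-] <-]]; exists (l i t); first exact: l_maps.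
      by rewrite /skew_product/= finv.
    move=> _ [_ /l_covers[i [s [Ds <-]]] <-]; exists i => //.
    by exists (s, f s); [exists s|rewrite /skew_product/= finv].
move=> C [[p0 Cp0] Ccompact CD Cfix].
have C_inv p : C p -> exists i p', C p' /\ skew_product i p' = p.
  by rewrite -{1}Cfix => -[i _ [p' Cp' <-]]; exists i, p'.
have C_maps i p : C p -> C (skew_product i p).
  by move=> Cp; rewrite -Cfix; exists i => //; exists p.
have Cfst p : C p -> D p.1 by case/CD.
have C_graph p : C p -> p.2 = f p.1.
  have cf : compact [set f t | t in D] by exact: continuous_compact.
  have cC : compact [set p.2 | p in C].
    apply: continuous_compact => //; apply: continuous_subspaceT => q.
    exact: cvg_snd.
  have [M1 fM1] := compact_mdist_bounded p0.2 cf.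
  have [M2 CM2] := compact_mdist_bounded p0.2 cC.
  move=> Cp; apply: (@mdist_geometric_eq _ _ (M1 + M2) _ _ _ c01) => m.
  elim: m p Cp => [|m IHm] p Cp.
    rewrite expr0 mulr1 (le_trans (metric_triangle _ p0.2 _))//.
    rewrite addrC lerD//; last by rewrite metric_sym CM2//; exists p.
    by rewrite fM1//; exists p.1 => //; exact: Cfst.
  have [i [p' [Cp' <-]]] := C_inv _ Cp; have Dp' := Cfst _ Cp'.
  rewrite /skew_product/= finv// (le_trans (Fc _ _ _ _ Dp'))//.
  by rewrite exprS mulrCA ler_wpM2l ?IHm.
have [Delta DDelta] := compact_mdist_bounded p0.1 Dcompact.
have C_dense m t : D t -> exists2 p, C p & mdist t p.1 <= Delta * k ^+ m.
  elim: m t => [|m IHm] t Dt.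
    by exists p0 => //; rewrite expr0 mulr1 metric_sym; exact: DDelta.
  have [i [s [Ds <-]]] := l_covers Dt; have [p Cp sp] := IHm s Ds.
  exists (skew_product i p); first exact: C_maps.
  rewrite /= (le_trans (lk _ _ _ Ds (Cfst _ Cp)))//.
  by rewrite exprS mulrCA ler_wpM2l.
have C1_closed : closed [set p.1 | p in C].
  apply: compact_closed; first exact: metric_hausdorff.
  apply: continuous_compact => //; apply: continuous_subspaceT => q.
  exact: cvg_fst.
apply/seteqP; split => [p Cp|_ [t Dt <-]].
  by exists p.1; [exact: Cfst|rewrite -C_graph//; case: (p)].
have [p Cp <-] : [set p.1 | p in C] t.
  apply: C1_closed => U /nbhs_ballP[e /= e0 eU].
  have [m me] := geometric_lt Delta k01 e0.
  have [p Cp tp] := C_dense m t Dt.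
  exists p.1; split; first by exists p.
  by apply: eU; rewrite ballEmdist/=; exact: le_lt_trans me.
by rewrite -C_graph//; case: (p) Cp.
Qed.

End invariant_graph.

(** * Completeness of the space of fuzzy numbers *)

Section fuzzy_completeness.
Context {R : realType}.
Implicit Types (u v w : fuzzy R) (a b e p r : R).

Lemma lower_itv u a p r : p <= r -> level u a = `[p, r]%classic -> lower u a = p.
Proof. by move=> pr; rewrite /lower => ->; exact: inf_itvcc. Qed.

Lemma upper_itv u a p r : p <= r -> level u a = `[p, r]%classic -> upper u a = r.
Proof. by move=> pr; rewrite /upper => ->; exact: sup_itvcc. Qed.

(** Left continuity of the lower end point in the level.  If y lies below the
    level set at a, then u y < a and any level strictly between u y and a
    still excludes y, on the same side as before since level sets are nested. *)
Lemma lower_left_lt u a y : 0 < a <= 1 -> y < lower u a ->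
  exists2 b, 0 < b < a & y < lower u b.
Proof.
move=> /andP[a0 a1] ya; have a01 : 0 <= a <= 1 by rewrite ltW.
have uya : u y < a.
  rewrite ltNge; apply/negP => auy.
  have : level u a y by rewrite level_gt0.
  by rewrite level_itv//= in_itv/= leNgt ya.
have u0 := membership_ge0 u y.
exists ((u y + a) / 2); first by apply/andP; split; lra.
have b01 : 0 <= (u y + a) / 2 <= 1 by apply/andP; split; lra.
have b0 : 0 < (u y + a) / 2 by lra.
have : ~ level u ((u y + a) / 2) y by rewrite level_gt0//=; apply/negP; lra.
rewrite level_itv//= in_itv/= => /negP; rewrite negb_and -!ltNge => /orP[//|].
have ba : (u y + a) / 2 <= a by lra.
by have := upper_anti u (ltW b0) ba a1; have := lower_le_upper u a01; lra.
Qed.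

Lemma upper_left_gt u a y : 0 < a <= 1 -> upper u a < y ->
  exists2 b, 0 < b < a & upper u b < y.
Proof.
move=> /andP[a0 a1] ya; have a01 : 0 <= a <= 1 by rewrite ltW.
have uya : u y < a.
  rewrite ltNge; apply/negP => auy.
  have : level u a y by rewrite level_gt0.
  by rewrite level_itv//= in_itv/= [X in _ && X]leNgt ya andbF.
have u0 := membership_ge0 u y.
exists ((u y + a) / 2); first by apply/andP; split; lra.
have b01 : 0 <= (u y + a) / 2 <= 1 by apply/andP; split; lra.
have b0 : 0 < (u y + a) / 2 by lra.
have : ~ level u ((u y + a) / 2) y by rewrite level_gt0//=; apply/negP; lra.
rewrite level_itv//= in_itv/= => /negP; rewrite negb_and -!ltNge => /orP[|//].
have ba : (u y + a) / 2 <= a by lra.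
by have := lower_mono u (ltW b0) ba a1; have := lower_le_upper u a01; lra.
Qed.

(** The Hausdorff distance of two intervals is controlled by that of their end
    points; the witness is the projection of y to the second interval. *)
Lemma itv_perturb (p r p' r' e y : R) : p' <= r' ->
  `|p - p'| <= e -> `|r - r'| <= e -> p <= y <= r ->
  exists2 z, p' <= z <= r' & `|y - z| <= e.
Proof.
rewrite !ler_norml => pr' /andP[? ?] /andP[? ?] /andP[? ?].
have [yp|py] := leP y p'.
  by exists p'; rewrite ?lexx// ler_norml; apply/andP; split; lra.
have [ry|yr] := leP r' y.
  by exists r'; rewrite ?lexx ?andbT// ler_norml; apply/andP; split; lra.
by exists y; rewrite ?(ltW py) ?(ltW yr)// subrr normr0; lra.
Qed.

(** Each property that makes a family of intervals the level sets of a fuzzy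
    number survives a uniform limit: a violation by d would be visible on an
    approximant within d / 4.  The only delicate one is that the level set at 0
    is the closure of the union of the others, that is, right continuity at 0:
    a point y of the limit interval at 0 is moved to the approximant v, then
    into the open support of v, at a point z' of level v z' > 0, and back to
    the limit interval at the level v z'. *)
Lemma fuzzy_of_uniform_limit (lo up : R -> R) :
  (forall e, 0 < e -> exists v, forall a, 0 <= a <= 1 ->
    `|lower v a - lo a| <= e /\ `|upper v a - up a| <= e) ->
  exists w, forall a, 0 <= a <= 1 -> lower w a = lo a /\ upper w a = up a.
Proof.
move=> approx.
have sW a : 0 < a <= 1 -> 0 <= a <= 1 by move=> /andP[/ltW-> ->].
have lo_up a : 0 <= a <= 1 -> lo a <= up a.
  move=> a01; rewrite leNgt; apply/negP => lt.
  have /approx[v /(_ a a01)[]] : 0 < (lo a - up a) / 4 by lra.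
  have := lower_le_upper v a01.
  by rewrite !ler_norml => ? /andP[? ?] /andP[? ?]; lra.
have lo_mono a b : 0 <= a -> a <= b -> b <= 1 -> lo a <= lo b.
  move=> a0 ab b1; rewrite leNgt; apply/negP => lt.
  have /approx[v vP] : 0 < (lo a - lo b) / 4 by lra.
  have a01 : 0 <= a <= 1 by rewrite a0 (le_trans ab).
  have b01 : 0 <= b <= 1 by rewrite b1 (le_trans a0).
  have [+ _] := vP a a01.
  have [+ _] := vP b b01.
  have := lower_mono v a0 ab b1.
  by rewrite !ler_norml => ? /andP[? ?] /andP[? ?]; lra.
have up_anti a b : 0 <= a -> a <= b -> b <= 1 -> up b <= up a.
  move=> a0 ab b1; rewrite leNgt; apply/negP => lt.
  have /approx[v vP] : 0 < (up b - up a) / 4 by lra.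
  have a01 : 0 <= a <= 1 by rewrite a0 (le_trans ab).
  have b01 : 0 <= b <= 1 by rewrite b1 (le_trans a0).
  have [_ +] := vP a a01.
  have [_ +] := vP b b01.
  have := upper_anti v a0 ab b1.
  by rewrite !ler_norml => ? /andP[? ?] /andP[? ?]; lra.
pose L a : set R := `[lo a, up a]%classic.
have [w wL] : {w : fuzzy R | forall a, 0 <= a <= 1 -> level w a = L a}.
  apply: fuzzy_of_levels.
  - by exists (lo 1); rewrite /L/= in_itv/= lexx lo_up// ler01 lexx.
  - by move=> a _; exact: itv_closed.
  - by move=> a _; exact: interval_is_interval.
  - move=> a b a0 ab b1 y; rewrite /L/= !in_itv/= => /andP[ly yu].
    rewrite (le_trans (lo_mono _ _ (ltW a0) ab b1))//=.
    by rewrite (le_trans yu)// up_anti// ltW.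
  - move=> a y a01 Lb; rewrite /L/= in_itv/=; have a01' := sW _ a01.
    apply/andP; split; rewrite leNgt; apply/negP => lt.
      have /approx[v vP] : 0 < (lo a - y) / 4 by lra.
      have [+ _] := vP a a01'; rewrite ler_norml => /andP[? ?].
      have [|b b0a] := @lower_left_lt v a (y + (lo a - y) / 4) a01; first by lra.
      have b01 : 0 <= b <= 1.
        case/andP: a01; case/andP: b0a => *; apply/andP; split; lra.
      have [+ _] := vP b b01; have := Lb b b0a; rewrite /L/= in_itv/= ler_norml.
      by move=> /andP[? ?] /andP[? ?] ?; lra.
    have /approx[v vP] : 0 < (y - up a) / 4 by lra.
    have [_ +] := vP a a01'; rewrite ler_norml => /andP[? ?].
    have [|b b0a] := @upper_left_gt v a (y - (y - up a) / 4) a01; first by lra.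
    have b01 : 0 <= b <= 1.
        case/andP: a01; case/andP: b0a => *; apply/andP; split; lra.
    have [_ +] := vP b b01; have := Lb b b0a; rewrite /L/= in_itv/= ler_norml.
    by move=> /andP[? ?] /andP[? ?] ?; lra.
  - exact: segment_compact.
  - apply/seteqP; split.
      rewrite closureE; apply: smallest_sub; first exact: itv_closed.
      move=> y [a /sW/andP[a0 a1]]; rewrite /L/= !in_itv/= => /andP[ly yu].
      by rewrite (le_trans (lo_mono _ _ _ a0 a1))//= (le_trans yu) ?up_anti.
    move=> y Ly B /nbhs_ballP[e /= e0 eB].
    have i0 : 0 <= (0 : R) <= 1 by rewrite lexx ler01.
    have /approx[v vP] : 0 < e / 4 by lra.
    have [] := vP 0 i0; rewrite distrC [X in _ -> X <= _ -> _]distrC => l0 u0.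
    move: Ly; rewrite /L/= in_itv/= => Ly.
    have [z zv yz] := itv_perturb (lower_le_upper v i0) l0 u0 Ly.
    have : level v 0 z by rewrite level_itv//= in_itv.
    have e40 : 0 < e / 4 by lra.
    rewrite level0 => /(_ _ (nbhsx_ballx z _ e40))[z' [/= vz' zz']].
    have a01 : 0 < v z' <= 1 by rewrite vz' membership_le1.
    have : level v (v z') z' by rewrite level_gt0/=.
    have [l1 u1] := vP _ (sW _ a01).
    rewrite level_itv ?sW//= in_itv/= => zv'.
    have [x Lx z'x] := itv_perturb (lo_up _ (sW _ a01)) l1 u1 zv'.
    exists x; split; first by exists (v z').
    apply: eB; move: zz' z'x yz; rewrite /ball/= !ltr_norml !ler_norml.
    by move=> /andP[? ?] /andP[? ?] /andP[? ?]; apply/andP; split; lra.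
exists w => a a01; split.
  by apply: (lower_itv (lo_up _ a01)); exact: wL.
by apply: (upper_itv (lo_up _ a01)); exact: wL.
Qed.

Lemma lower_dinf u v a : 0 <= a <= 1 -> `|lower u a - lower v a| <= dinf u v.
Proof. by move=> /(dinf_ge u v); rewrite ge_max => /andP[]. Qed.

Lemma upper_dinf u v a : 0 <= a <= 1 -> `|upper u a - upper v a| <= dinf u v.
Proof. by move=> /(dinf_ge u v); rewrite ge_max => /andP[]. Qed.

Theorem fuzzy_complete : cauchy_complete (fuzzy R).
Proof.
move=> F FF Fc.
have /choice[lo loP] : forall a, exists r, 0 <= a <= 1 ->
    forall v e, F (ball v e) -> `|lower v a - r| <= e.
  move=> a; have [a01|] := boolP (0 <= a <= 1); last by exists 0.
  have h1 u v := lower_dinf u v a01.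
  by have [r rP] := nonexpansive_cauchy_limit FF Fc h1; exists r.
have /choice[up upP] : forall a, exists r, 0 <= a <= 1 ->
    forall v e, F (ball v e) -> `|upper v a - r| <= e.
  move=> a; have [a01|] := boolP (0 <= a <= 1); last by exists 0.
  have h1 u v := upper_dinf u v a01.
  by have [r rP] := nonexpansive_cauchy_limit FF Fc h1; exists r.
have [w wP] : exists w, forall a, 0 <= a <= 1 ->
    lower w a = lo a /\ upper w a = up a.
  apply: fuzzy_of_uniform_limit => e e0.
  have /cauchyP/(_ e e0)[v Fv] := Fc.
  by exists v => a a01; split; [exact: loP|exact: upP].
exists w; apply/mdist_fcvgP => e e0.
have e20 : 0 < e / 2 by lra.
have /cauchyP/(_ _ e20)[v Fv] := Fc.
have vw : mdist w v <= e / 2.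
  rewrite metric_sym mdist_fuzzyE; apply: dinf_le => a a01.
  by have [-> ->] := wP a a01; rewrite ge_max loP// upP.
apply: filterS Fv => u; rewrite ballEmdist/= => vu.
by rewrite (splitr e) (le_lt_trans (metric_triangle _ v _))// ler_ltD.
Qed.

End fuzzy_completeness.

(** * The operations on end points *)

Section fuzzy_operations.
Context {R : realType}.
Implicit Types (u v w : fuzzy R) (a c : R).

Lemma lower_add u v a : 0 <= a <= 1 ->
  lower (fuzzy_add u v) a = lower u a + lower v a.
Proof.
by move=> a01; rewrite /lower level_add// inf_sumE//; exact: level_has_inf.
Qed.

Lemma upper_add u v a : 0 <= a <= 1 ->
  upper (fuzzy_add u v) a = upper u a + upper v a.
Proof.
by move=> a01; rewrite /upper level_add// sup_sumE//; exact: level_has_sup.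
Qed.

Lemma level_scale_itv c u a : 0 <= c -> 0 <= a <= 1 ->
  level (fuzzy_scale c u) a = `[c * lower u a, c * upper u a]%classic.
Proof.
move=> c0 a01; rewrite level_scale// level_itv//; have lu := lower_le_upper u a01.
apply/seteqP; split => [_ [y + <-]|y]; rewrite /= !in_itv/=.
  by move=> /andP[ly yu]; rewrite !ler_wpM2l.
(* For c = 0 the image is the singleton 0 because the level set is nonempty. *)
have [->|cn0] := eqVneq c 0.
  rewrite !mul0r => y0; exists (lower u a); first by rewrite /= in_itv/= lexx lu.
  by rewrite mul0r; apply/eqP; rewrite eq_le.
have {cn0}c0 : 0 < c by rewrite lt_neqAle eq_sym cn0.
move=> /andP[ly yu]; exists (y / c); last by rewrite mulrC divfK// gt_eqF.
by rewrite /= in_itv/= ler_pdivlMr// ler_pdivrMr// ![_ * c]mulrC ly.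
Qed.

Lemma lower_scale c u a : 0 <= c -> 0 <= a <= 1 ->
  lower (fuzzy_scale c u) a = c * lower u a.
Proof.
move=> c0 a01; apply: (lower_itv _ (level_scale_itv u c0 a01)).
by rewrite ler_wpM2l// lower_le_upper.
Qed.

Lemma upper_scale c u a : 0 <= c -> 0 <= a <= 1 ->
  upper (fuzzy_scale c u) a = c * upper u a.
Proof.
move=> c0 a01; apply: (upper_itv _ (level_scale_itv u c0 a01)).
by rewrite ler_wpM2l// lower_le_upper.
Qed.

Lemma dinf_scale_add c u u' v v' : 0 <= c ->
  dinf (fuzzy_add (fuzzy_scale c u) v) (fuzzy_add (fuzzy_scale c u') v')
    <= c * dinf u u' + dinf v v'.
Proof.
move=> c0; apply: dinf_le => a a01.
have sep (p p' r r' : R) :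
    `|c * p + r - (c * p' + r')| <= c * `|p - p'| + `|r - r'|.
  have -> : c * p + r - (c * p' + r') = c * (p - p') + (r - r') by ring.
  by rewrite (le_trans (ler_normD _ _))// normrM (ger0_norm c0).
rewrite !lower_add// !upper_add// !lower_scale// !upper_scale// ge_max.
apply/andP; split; apply: (le_trans (sep _ _ _ _)); rewrite lerD//.
- by rewrite ler_wpM2l ?lower_dinf.
- exact: lower_dinf.
- by rewrite ler_wpM2l ?upper_dinf.
- exact: upper_dinf.
Qed.

End fuzzy_operations.

(** * The subdivision of the interval *)

Section node_facts.
Context {R : realType} {n : nat} (x : 'I_n.+1 -> R).
Hypothesis x_increasing : forall i j : 'I_n.+1, (i < j)%N -> x i < x j.

Lemma node_le (i j : 'I_n.+1) : (i <= j)%N -> x i <= x j.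
Proof.
by rewrite leq_eqVlt => /predU1P[/val_inj->//|/x_increasing/ltW].
Qed.

Lemma node_inj (i j : 'I_n.+1) : x i = x j -> i = j.
Proof.
move=> xij; apply: val_inj; case: (ltngtP i j) => // /x_increasing.
  by rewrite xij ltxx.
by rewrite xij ltxx.
Qed.

Lemma node_subinterval_cover (n_gt0 : (0 < n)%N) (t : R) :
  node_interval x t -> exists i, node_subinterval x i t.
Proof.
rewrite /node_interval/= in_itv/= => /andP[x0t txn].
suff cover m : (m <= n)%N -> t <= x (inord m) ->
    exists i, node_subinterval x i t.
  by apply: (cover n) => //; rewrite (_ : inord n = ord_max)//; apply: val_inj;
    rewrite /= inordK.
elim: m => [_ tx0|m IHm mn txm].
  have t0 : t = x ord0.
    apply/eqP; rewrite eq_le x0t (_ : ord0 = inord 0) ?tx0//.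
    by apply: val_inj; rewrite /= inordK.
  exists (Ordinal n_gt0); rewrite /node_subinterval/= in_itv/= t0.
  by rewrite !node_le.
have [txm'|txm'] := leP t (x (inord m)); first by apply: IHm => //; exact: ltnW.
exists (Ordinal mn); rewrite /node_subinterval/= in_itv/=; apply/andP; split.
  rewrite (_ : left_node _ = inord m) ?ltW//; apply: val_inj => /=.
  by rewrite inordK// ltnS ltnW.
rewrite (_ : right_node _ = inord m.+1)//; apply: val_inj => /=.
by rewrite inordK.
Qed.

Lemma node_subinterval_sub i : node_subinterval x i `<=` node_interval x.
Proof.
move=> t; rewrite /node_subinterval /node_interval/= !in_itv/= => /andP[lt tr].
by rewrite (le_trans _ lt) ?node_le//= (le_trans tr) ?node_le// -ltnS ltn_ord.
Qed.

Lemma node_subinterval_meet (i j : 'I_n) (t : R) : (i < j)%N ->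
  node_subinterval x i t -> node_subinterval x j t ->
  right_node i = left_node j /\ t = x (right_node i).
Proof.
move=> ij; rewrite /node_subinterval/= !in_itv/= => /andP[_ tr] /andP[lt _].
have rl : x (right_node i) <= x (left_node j) by exact: node_le.
have tE : t = x (right_node i) by apply/eqP; rewrite eq_le tr (le_trans rl).
split=> //; apply: node_inj; apply/eqP; rewrite eq_le rl/=.
by rewrite -tE.
Qed.

End node_facts.

Lemma finite_family_lt1 (R : realType) (n : nat) (a : 'I_n -> R) :
  (forall i, 0 <= a i < 1) -> exists2 b, 0 <= b < 1 & forall i, a i <= b.
Proof.
move=> a01; exists (\big[Num.max/0]_i a i); last by move=> i; exact: le_bigmax.
rewrite bigmax_ge_id /=; apply/bigmax_ltP; split => // i _.
by case/andP: (a01 i).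
Qed.

(** * Interpolation by fuzzy numbers *)

Theorem theorem3 (R : realType) (n : nat) (n_gt0 : (0 < n)%N)
    (x : 'I_n.+1 -> R)
    (x_increasing : forall i j : 'I_n.+1, (i < j)%N -> x i < x j)
    (u : 'I_n.+1 -> fuzzy R)
    (l : 'I_n -> R -> R) (s : 'I_n -> R) (q : 'I_n -> R -> fuzzy R)
    (l_homeomorphism : forall i : 'I_n,
      homeomorphism (node_interval x) (node_subinterval x i) (l i))
    (l_contractive : forall i : 'I_n,
      contractive_map (X := R^o) (Y := R^o) (node_interval x) (l i))
    (l_first : forall i : 'I_n, l i (x ord0) = x (left_node i))
    (l_last : forall i : 'I_n, l i (x ord_max) = x (right_node i))
    (s_bound : forall i : 'I_n, 0 <= s i < 1)
    (q_lipschitz : forall i : 'I_n,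
      lipschitz_map (X := R^o) (node_subinterval x i) (q i))
    (F_first : forall i : 'I_n,
      fif_F l s q i (x ord0) (u ord0) = u (left_node i))
    (F_last : forall i : 'I_n,
      fif_F l s q i (x ord_max) (u ord_max) = u (right_node i)) :
  exists2 B : set (R * fuzzy R),
    is_attractor (node_interval x `*` [set: fuzzy R]) (fif_w l s q) B &
    exists2 f : R -> fuzzy R,
      {within node_interval x, continuous f} &
      B = [set (t, f t) | t in node_interval x].
Proof.
set D := node_interval x; set F := fif_F l s q.
have x0n : x ord0 < x ord_max by exact: x_increasing.
have Dx0 : D (x ord0) by rewrite /D /node_interval/= in_itv/= lexx ltW.
have Dxn : D (x ord_max) by rewrite /D /node_interval/= in_itv/= lexx ltW.
have Dcompact : compact D by exact: segment_compact.
have limage i : l i @` D = node_subinterval x i.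
  have [[lD _ lsurj] _ _] := l_homeomorphism i.
  by apply/seteqP; split => // _ [t Dt <-]; exact: lD.
have linj i t t' : D t -> D t' -> l i t = l i t' -> t = t'.
  by have [[_ li _] _ _] := l_homeomorphism i => Dt Dt'; apply: li; rewrite inE.
have lsub i t : D t -> node_subinterval x i (l i t).
  by move=> Dt; rewrite -limage; exists t.
have Dself : hutchinson l D = D.
  apply/seteqP; split => [_ [i _ [t Dt <-]]|t].
    exact: node_subinterval_sub (lsub i t Dt).
  move=> /(node_subinterval_cover x_increasing n_gt0)[i].
  by rewrite -limage; exists i.
have /choice[k' k'P] : forall i, exists k, 0 <= k < 1 /\
    lipschitz_with (X := R^o) (Y := R^o) D k (l i).
  by move=> i; have [k k01 lk] := l_contractive i; exists k.
have [k k01 k'k] := finite_family_lt1 (fun i => (k'P i).1).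
have lk i : lipschitz_with (X := R^o) (Y := R^o) D k (l i).
  move=> t t' Dt Dt'; rewrite (le_trans ((k'P i).2 _ _ Dt Dt'))//.
  by rewrite ler_wpM2r// mdist_ge0.
have [c c01 sc] := finite_family_lt1 s_bound; have /andP[c0 c1] := c01.
have /choice[K' K'P] : forall i, exists K, 0 <= K /\
    lipschitz_with (X := R^o) (node_subinterval x i) K (q i).
  by move=> i; have [K K0 qK] := q_lipschitz i; exists K.
pose K := \sum_i K' i.
have K0 : 0 <= K by apply: sumr_ge0 => i _; exact: (K'P i).1.
have K'K i : K' i <= K.
  by rewrite /K (bigD1 i)//= lerDl sumr_ge0// => j _; exact: (K'P j).1.
have FL i t t' v v' : D t -> D t' ->
    mdist (F i t v) (F i t' v') <= K * mdist (t : R^o) t' + c * mdist v v'.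
  move=> Dt Dt'; have /andP[s0 _] := s_bound i.
  rewrite !mdist_fuzzyE (le_trans (dinf_scale_add _ _ _ _ s0))// addrC.
  rewrite lerD//; last by rewrite ler_wpM2r// -mdist_fuzzyE mdist_ge0.
  rewrite -mdist_fuzzyE (le_trans ((K'P i).2 _ _ (lsub i t Dt) (lsub i t' Dt')))//.
  rewrite ler_pM ?(K'P i).1 ?mdist_ge0//.
  rewrite (le_trans (lk i _ _ Dt Dt'))// ler_piMl ?mdist_ge0//.
  by case/andP: k01 => _ /ltW.
have Fc i t v v' : D t -> mdist (F i t v) (F i t v') <= c * mdist v v'.
  by move=> Dt; have := FL i t t v v' Dt Dt; rewrite mdistxx mulr0 add0r.
(* On functions with these two values the prescriptions at a common end point
   of two subintervals agree. *)
pose P (g : R -> fuzzy R) := g (x ord0) = u ord0 /\ g (x ord_max) = u ord_max.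
(* The subintervals i < j meet only if they are consecutive, in the image of
   the last node under l_i and of the first node under l_j. *)
have Pcoherent_lt (g : R -> fuzzy R) (i j : 'I_n) t t' : (i < j)%N ->
    P g -> D t -> D t' -> l i t = l j t' -> F i t (g t) = F j t' (g t').
  move=> ij [g0 gn] Dt Dt' ltt'.
  have lit := lsub i t Dt; have ljt := lsub j t' Dt'.
  rewrite -ltt' in ljt.
  have [rl litE] := node_subinterval_meet x_increasing ij lit ljt.
  have tE : t = x ord_max by apply: (linj i) => //; rewrite l_last.
  have t'E : t' = x ord0 by apply: (linj j) => //; rewrite l_first -ltt' litE rl.
  by rewrite tE t'E g0 gn /F F_first F_last rl.
have Pcoherent (g : R -> fuzzy R) (i j : 'I_n) t t' :
    P g -> D t -> D t' -> l i t = l j t' -> F i t (g t) = F j t' (g t').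
  move=> Pg Dt Dt' ltt'; case: (ltngtP i j) => [ij|ji|/val_inj ij].
  - exact: Pcoherent_lt ltt'.
  - by apply/esym; apply: Pcoherent_lt (esym ltt').
  - by rewrite ij in ltt' *; rewrite (linj _ _ _ Dt Dt' ltt').
have Pstable (g h : R -> fuzzy R) : P g ->
    (forall i t, D t -> h (l i t) = F i t (g t)) -> P h.
  move=> [g0 gn] hF.
  have l0 : left_node (Ordinal n_gt0) = ord0 by exact: val_inj.
  have n1n : (n.-1 < n)%N by rewrite prednK.
  have rn : right_node (Ordinal n1n) = ord_max.
    by apply: val_inj; rewrite /= /bump/= add1n prednK.
  split.
    by rewrite -{1}l0 -l_first hF// g0 /F F_first l0.
  by rewrite -{1}rn -l_last hF// gn /F F_last rn.
pose g0 t := if t == x ord_max then u ord_max else u ord0.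
have Pg0 : P g0 by rewrite /P /g0 eqxx lt_eqF.
pose delta := mdist (u ord0) (u ord_max).
have g0delta t : mdist (g0 t) (u ord0) <= delta.
  by rewrite /g0; case: ifPn => _; rewrite ?mdistxx ?mdist_ge0// metric_sym.
pose S := \sum_j mdist (u ord0) (u j).
have uS j : mdist (u ord0) (u j) <= S.
  by rewrite /S (bigD1 j)//= lerDl sumr_ge0// => i _; exact: mdist_ge0.
(* The first step is estimated by comparing both values with the node value
   F_i (x_0, u_0), which is the left node value of the i-th subinterval. *)
pose M := delta + S + (K * (x ord_max - x ord0) + c * delta).
have M0 : 0 <= M.
  have delta0 : 0 <= delta by exact: mdist_ge0.
  have S0 : 0 <= S by apply: sumr_ge0 => j _; exact: mdist_ge0.
  by rewrite !addr_ge0// mulr_ge0// subr_ge0 ltW.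
have g0M i t : D t -> mdist (g0 (l i t)) (F i t (g0 t)) <= M.
  move=> Dt; rewrite (le_trans (metric_triangle _ (u (left_node i)) _))// lerD//.
    by rewrite (le_trans (metric_triangle _ (u ord0) _))// lerD.
  rewrite -F_first metric_sym (le_trans (FL i _ _ _ _ Dt Dx0))// lerD//.
    rewrite ler_wpM2l// /mdist/=.
    by move: Dt; rewrite /D /node_interval/= in_itv/= ler_norml; lra.
  by rewrite ler_wpM2l.
have [f finv fg0] := exists_invariant_function (X := R^o) Dself c01
  (@fuzzy_complete R) Fc Pcoherent Pstable Pg0 M0 g0M.
have fbounded t t' : D t -> D t' ->
    mdist (f t) (f t') <= M / (1 - c) + (delta + delta) + M / (1 - c).
  move=> Dt Dt'.
  apply: (le_trans (metric_triangle _ (g0 t') _)).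
  apply: lerD (fg0 _ Dt').
  apply: (le_trans (metric_triangle _ (g0 t) _)); apply: lerD.
    by rewrite metric_sym; exact: fg0.
  apply: (le_trans (metric_triangle _ (u ord0) _)); apply: lerD => //.
  by rewrite metric_sym.
have fcont : {within D, continuous f}.
  apply: (invariant_function_continuous (X := R^o) Dself c01 Dcompact _ K0 FL
    finv fbounded) => i.
  by rewrite limage; exact: l_homeomorphism.
exists [set (t, f t) | t in D]; last by exists f.
apply: (invariant_graph_attractor (X := R^o) Dself c01 Dcompact _ k01 lk Fc
  finv fcont).
by exists (x ord0).
Qed.
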